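(* Let $(P_n)_n$ be the monic matrix orthogonal polynomials of a weight $W$ and $(Q_x)_x$ a dual family for $(P_n)_n$ (with data $\rho,\Upsilon$). Then the diagram formed by $$\psi:\hat{\mathcal F}_L(P)\to\hat{\mathcal F}_R(P),\quad \sigma:\hat{\mathcal F}_R(P)\to\hat{\mathcal F}_R^d(Q),\quad \psi^d:\hat{\mathcal F}_R^d(Q)\to\hat{\mathcal F}_L^d(Q),\quad \tau:\hat{\mathcal F}_L(P)\to\hat{\mathcal F}^d_L(Q)$$ is commutative, i.e. $\tau(M)=\psi^d(\sigma(\psi(M)))$ for all $M\in\hat{\mathcal F}_L(P)$.
   Context: $\mathbb N_0=\{0,1,2,\dots\}$; $N\ge1$ fixed. A weight is $W:\mathbb Z\to M_N(\mathbb C)$ with $W(x)$ positive definite for $x\in\mathbb N_0$, $W(x)=0$ for $x<0$, with finite moments of all orders; $\langle P,Q\rangle=\sum_{x\ge0}P(x)W(x)Q(x)^*$; $(P_n)_n$ are the monic matrix orthogonal polynomials, $\deg P_n=n$, $\langle P_m,P_n\rangle=\mathcal H_m\delta_{m,n}$; $P_{n}=0$ for $n<0$. Fourier algebras of $P$. $\mathcal M_N$: operators $D=\sum_{j=-\ell}^m\eta^jF_j(x)$ with $F_j$ matrix functions rational in $x$, acting on the right by $(P_n\cdot D)(x)=\sum_jP_n(x+j)F_j(x)$. $\mathcal N_N$: operators $M=\sum_{j=-t}^sG_j(n)\delta^j$ with $G_j:\mathbb N_0\to M_N(\mathbb C)$ sequences, acting on the left by $(M\cdot P_n)(x)=\sum_{j\ge\max(-t,-n)}^sG_j(n)P_{n+j}(x)$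 (values $G_j(n)$ with $n+j<0$ play no role; operators differing only in them are identified). $\mathcal F_R(P)=\{D\in\mathcal M_N:\exists M\in\mathcal N_N,\ M\cdot P=P\cdot D\}$, $\mathcal F_L(P)=\{M\in\mathcal N_N:\exists D\in\mathcal M_N,\ M\cdot P=P\cdot D\}$, and $\psi:\mathcal F_L(P)\to\mathcal F_R(P)$ is the algebra isomorphism with $\psi(M)=D$ iff $M\cdot P=P\cdot D$. $\hat{\mathcal F}_R(P)$ is the subalgebra of those $D=\sum_{k=-\ell}^m\eta^kF_k(x)\in\mathcal F_R(P)$ with $F_k(x)=0$ for $k=-\ell,\dots,-1$ and $x=0,\dots,-k-1$; $\hat{\mathcal F}_L(P)=\psi^{-1}(\hat{\mathcal F}_R(P))$. Dual family. Matrix polynomials are evaluated at a matrix $\mathcal N$ with the variable on the left, $Q(\mathcal N)=\sum_k\mathcal N^kA_k$. $(Q_x)_{x\in\mathbb N_0}$ are monic matrix polynomials, $\deg Q_x=x$, with $P_n(x)=P_n(0)Q_x(\rho(n))\Upsilon(x)$ for all $x,n\in\mathbb N_0$, where $P_n(0)$ and $\Upsilon(x)$ are invertible on $\mathbb N_0$, $\Upsilon(0)=I$, $\Upsilon(x+1)^{-1}\Upsilon(x)$ is rational in $x$, and for some matrices $\mathcal Y_x,\mathcal Z_x$ one has $\rho(n)Q_x(\rho(n))=Q_{x+1}(\rho(n))+Q_x(\rho(n))\mathcal Y_x+Q_{x-1}(\rho(n))\mathcal Z_x$ for all $x,n\in\mathbb N_0$ ($Q_0=I$, $Q_{-1}=0$,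 $\mathcal Z_0=0$). The entries of $\rho(n)$ are rational in $n$ without poles in $\mathbb N_0$, and for all $\nu,x\in\mathbb N_0$ the block Vandermonde matrix with $(i,j)$ block $\rho(\nu+i)^j$, $0\le i,j\le x$, is invertible. Standing assumptions: with $U(n)=P_n(0)^*\mathcal H_n^{-1}P_n(0)$, $\sum_nF(n)U(n)$ converges for every matrix function $F$ with rational entries and no poles in $\mathbb N_0$, and $R_1(\rho(n+1))^*P_{n+1}(0)^*\mathcal H_n^{-1}P_n(0)R_2(\rho(n))\to0$ as $n\to\infty$ for all matrix polynomials $R_1,R_2$. Dual Fourier algebras. $\mathcal M^d_N$: operators $\widetilde D=\sum_j\eta^jF_j(x)$ with $F_j:\mathbb N_0\to M_N(\mathbb C)$ sequences, acting by $(Q_x\cdot\widetilde D)(\rho(n))=\sum_jQ_{x+j}(\rho(n))F_j(x)$ ($Q_y=0$ for $y<0$). $\mathcal N_N^d$: operators $\widetilde M=\sum_jG_j(n)\delta^j$ with $G_j$ matrix valued rational functions of $n$, acting by $(\widetilde M\cdot Q_x)(\rho(n))=\sum_jG_j(n)Q_x(\rho(n+j))$ (as rational functions of $n$). $\mathcal F_R^d(Q)$, $\mathcal F_L^d(Q)$ are the sets of $\widetilde D\in\mathcal M_N^d$, resp. $\widetilde M\in\mathcal N_N^d$, for which there is $\widetilde M\in\mathcal N_N^d$, resp. $\widetilde D\in\mathcal M_N^d$, with $\widetilde M\cdot Q_x=Q_x\cdot\widetilde D$ for all $x$; $\psi^d:\mathcal F_R^d(Q)\to\mathcal F_L^d(Q)$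 is the isomorphism $\psi^d(\widetilde D)=\widetilde M$. Maps. For $D=\sum_j\eta^jF_j(x)\in\hat{\mathcal F}_R(P)$, $\sigma(D)=\sum_j\eta^j\Upsilon(x+j)F_j(x)\Upsilon(x)^{-1}$ (terms with $x+j<0$ being zero, since there $F_j(x)=0$). For $M=\sum_{j=-t}^sG_j(n)\delta^j\in\hat{\mathcal F}_L(P)$, the sequences $P_n(0)^{-1}G_j(n)P_{n+j}(0)$, $n\ge t$, extend uniquely to matrix valued rational functions $\widetilde G_j(n)$, and $\tau(M)=\sum_{j=-t}^s\widetilde G_j(n)\delta^j\in\mathcal F_L^d(Q)$. $\hat{\mathcal F}_R^d(Q)=\sigma(\hat{\mathcal F}_R(P))$ and $\hat{\mathcal F}_L^d(Q)=\tau(\hat{\mathcal F}_L(P))$. *)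

(* Defs.v *)
From HB Require Import structures.
From mathcomp Require Import all_boot all_order all_algebra finmap fraction.
From mathcomp Require Import all_classical all_reals all_analysis.
From mathcomp Require Export complex.
From mathcomp Require Import generic_quotient.

Set Implicit Arguments.
Unset Strict Implicit.
Unset Printing Implicit Defensive.

Import Order.TTheory GRing.Theory Num.Theory.
Import numFieldNormedType.Exports.

Local Open Scope classical_set_scope.
Local Open Scope ring_scope.
Local Open Scope sesquilinear_scope.

(* Extension by zero from N_0 to Z: P_n = 0 for n < 0, Q_y = 0 for y < 0. *)
Definition ext0 (V : zmodType) (f : nat -> V) (k : int) : V :=
  if k is Posz n then f n else 0.

(* Evaluation with the variable on the left; [horner] has it on the right. *)
Definition leval (S : nzRingType) (p : {poly S}) (a : S) : S :=
  \sum_(k < size p) a ^+ k * p`_k.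

Section RationalFunctions.
Variable K : numClosedFieldType.

Definition ratfun : fieldType := {fraction {poly K}}.

(* f has no pole at a and takes there the value v *)
Definition rat_at (f : ratfun) (a v : K) : Prop :=
  exists p q : {poly K},
    [/\ q.[a] != 0, f = tofrac p / tofrac q & v = p.[a] / q.[a]].

(* the value at a, with junk value 0 at a pole *)
Definition rat_eval (f : ratfun) (a : K) : K := xget 0 [set v | rat_at f a v].

Definition ratC (c : K) : ratfun := tofrac c%:P.

(* the rational function x + j *)
Definition ratXD (j : int) : ratfun := tofrac ('X + (j%:~R)%:P).

(* f(x) |-> f(x + j), independent of the representative of f *)
Definition rat_shift (f : ratfun) (j : int) : ratfun :=
  tofrac ((frac (repr f)).1 \Po ('X + (j%:~R)%:P))
  / tofrac ((frac (repr f)).2 \Po ('X + (j%:~R)%:P)).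

Variable N : nat.

(* dimension N.+1, i.e. an arbitrary dimension >= 1 *)
Local Notation cmx := 'M[K]_N.+1.
Local Notation rmx := 'M[ratfun]_N.+1.

Definition rmx_at (F : rmx) (a : K) (V : cmx) : Prop :=
  forall i j, rat_at (F i j) a (V i j).
Definition rmx_regular (F : rmx) : Prop :=
  forall n : nat, exists V : cmx, rmx_at F n%:R V.
Definition rmx_eval (F : rmx) (n : nat) : cmx :=
  map_mx (fun f => rat_eval f n%:R) F.
Definition rmx_shift (F : rmx) (j : int) : rmx :=
  map_mx (fun f => rat_shift f j) F.

Definition rmxC (A : cmx) : rmx := map_mx ratC A.
Definition rpoly (p : {poly cmx}) : {poly rmx} :=
  map_poly rmxC p.

End RationalFunctions.

Section OrthogonalPolynomials.
Variables (K : numClosedFieldType) (N : nat).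
Local Notation mx := 'M[K]_N.+1.

Definition posdef (A : mx) : Prop :=
  A ^t* = A /\
  forall v : 'rV[K]_N.+1, v != 0 -> 0 < (v *m A *m v ^t*) ord0 ord0.

Definition is_weight (W : int -> mx) : Prop :=
  [/\ forall x : nat, posdef (W x%:Z),
      forall x : int, x < 0 -> W x = 0
    & forall k : nat,
        cvgn (series (fun x : nat => x%:R ^+ k *: W x%:Z))].

Definition inner (W : int -> mx) (P Q : {poly mx}) : mx :=
  limn (series (fun x : nat => P.[x%:R] * W x%:Z * Q.[x%:R] ^t*)).

Definition monic_seq (P : nat -> {poly mx}) : Prop :=
  forall n, P n \is monic /\ size (P n) = n.+1.

Definition is_mop (W : int -> mx) (P : nat -> {poly mx}) : Prop :=
  monic_seq P /\ forall m n, m != n -> inner W (P m) (P n) = 0.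

Definition sqnorm (W : int -> mx) (P : nat -> {poly mx}) (n : nat) : mx :=
  inner W (P n) (P n).

End OrthogonalPolynomials.

Section DualFamily.
Variables (K : numClosedFieldType) (N : nat).
Local Notation mx := 'M[K]_N.+1.
Local Notation rm := 'M[ratfun K]_N.+1.
Variables (W : int -> mx) (P : nat -> {poly mx}).
Variables (rho : rm) (Ups : nat -> mx) (Q : nat -> {poly mx}).

Local Notation H := (sqnorm W P).

Record is_dual_family : Prop := IsDualFamily {
  dual_monic : monic_seq Q;
  dual_rho : rmx_regular rho;
  dual_eq : forall n x : nat,
    (P n).[x%:R] = (P n).[0] * leval (Q x) (rmx_eval rho n) * Ups x;
  dual_P0 : forall n : nat, (P n).[0] \is a GRing.unit;
  dual_Ups : forall x : nat, Ups x \is a GRing.unit;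
  dual_Ups0 : Ups 0%N = 1;
  dual_Ups_rat : exists S : rm,
    forall x : nat, rmx_at S x%:R ((Ups x.+1)^-1 * Ups x);
  dual_rec : exists Y Z : nat -> mx, Z 0%N = 0 /\
    forall x n : nat,
      rmx_eval rho n * leval (Q x) (rmx_eval rho n) =
        leval (Q x.+1) (rmx_eval rho n)
        + leval (Q x) (rmx_eval rho n) * Y x
        + leval (ext0 Q (x%:Z - 1)) (rmx_eval rho n) * Z x;
  dual_vandermonde : forall nu x : nat,
    (\mxblock_(i < x.+1, j < x.+1)
      ((rmx_eval rho (nu + i)) ^+ j : 'M[K]_(N.+1, N.+1))) \in unitmx;
  dual_sum : forall F : rm, rmx_regular F ->
    cvgn (series (fun n : nat =>
      rmx_eval F n * ((P n).[0] ^t* * (H n)^-1 * (P n).[0])));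
  dual_lim : forall R1 R2 : {poly mx},
    (fun n : nat =>
       (leval R1 (rmx_eval rho n.+1)) ^t* * (P n.+1).[0] ^t* * (H n)^-1
       * (P n).[0] * leval R2 (rmx_eval rho n)) @ \oo --> (0 : mx)
}.

End DualFamily.

(* An operator is the finitely supported family of its coefficients; the four *)
(* spaces of operators share two coefficient types.                           *)
Section Fourier.
Variables (K : numClosedFieldType) (N : nat).
Local Notation mx := 'M[K]_N.+1.
Local Notation rm := 'M[ratfun K]_N.+1.

Definition rat_op := {fsfun int -> rm with 0}.
Definition seq_op := {fsfun int -> (nat -> mx) with (fun=> 0)}.

Definition MN := rat_op.
Definition NN := seq_op.
Definition MdN := seq_op.
Definition NdN := rat_op.

Variable P : nat -> {poly mx}.

(* (P_n . D)(x) and (M . P_n)(x), as rational functions of x *)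
Definition right_act (D : MN) (n : nat) : rm :=
  \sum_(j <- finsupp D) (rpoly (P n)).[(ratXD K j)%:M] * D j.
Definition left_act (M : NN) (n : nat) : rm :=
  \sum_(j <- finsupp M)
    rmxC (M j n) * (rpoly (ext0 P (n%:Z + j))).[(ratXD K 0)%:M].

Definition intertwine (M : NN) (D : MN) : Prop :=
  forall n : nat, left_act M n = right_act D n.

Definition FR : set MN := [set D | exists M : NN, intertwine M D].
Definition FL : set NN := [set M | exists D : MN, intertwine M D].

Definition psi (M : NN) : MN := xget [fsfun] [set D | intertwine M D].

Definition hatFR : set MN := [set D | FR D /\
  forall (k : int) (x : nat), x%:Z + k < 0 -> rmx_at (D k) x%:R 0].
Definition hatFL : set NN := [set M | FL M /\ hatFR (psi M)].

Variables (rho : rm) (Ups : nat -> mx) (Q : nat -> {poly mx}).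

(* (M . Q_x)(rho(n)) and (Q_x . D)(rho(n)), as rational functions of n *)
Definition dleft_act (M : NdN) (x : nat) : rm :=
  \sum_(j <- finsupp M) M j * leval (rpoly (Q x)) (rmx_shift rho j).
Definition dright_act (D : MdN) (x : nat) : rm :=
  \sum_(j <- finsupp D) leval (rpoly (ext0 Q (x%:Z + j))) rho * rmxC (D j x).

Definition dintertwine (D : MdN) (M : NdN) : Prop :=
  forall x : nat, dleft_act M x = dright_act D x.

Definition FdR : set MdN := [set D | exists M : NdN, dintertwine D M].
Definition FdL : set NdN := [set M | exists D : MdN, dintertwine D M].

Definition psid (D : MdN) : NdN := xget [fsfun] [set M | dintertwine D M].

Definition sigma (D : MN) : MdN :=
  [fsfun j in finsupp D =>
    (fun x : nat => ext0 Ups (x%:Z + j) * rmx_eval (D j) x * (Ups x)^-1)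
  | fun=> 0].

(* The coefficients of Mt are the rational extensions of the sequences        *)
(* P_n(0)^-1 G_j(n) P_{n+j}(0), n >= t; the premise on k says n >= t.         *)
Definition is_tau (M : NN) (Mt : NdN) : Prop :=
  forall (j : int) (n : nat),
    (forall k : int, k \in finsupp M -> 0 <= n%:Z + k) ->
    rmx_at (Mt j) n%:R ((P n).[0]^-1 * M j n * (ext0 P (n%:Z + j)).[0]).

Definition tau (M : NN) : NdN := xget [fsfun] [set Mt | is_tau M Mt].

Definition hatFdR : set MdN := sigma @` hatFR.
Definition hatFdL : set NdN := tau @` hatFL.

End Fourier.

(* Main.v *)
Require Import Defs.
From HB Require Import structures.
From mathcomp Require Import all_boot all_order all_algebra finmap fraction.
From mathcomp Require Import all_classical all_reals all_analysis.
From mathcomp Require Import generic_quotient ring zify.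

Set Implicit Arguments.
Unset Strict Implicit.
Unset Printing Implicit Defensive.

Import Order.TTheory GRing.Theory Num.Theory.

Local Open Scope classical_set_scope.
Local Open Scope ring_scope.

(** The duality P_n(x) = P_n(0) Q_x(rho(n)) Ups(x) turns a relation M.P = P.D
    into a relation for Q. At a natural number x it reads
      sum_j P_n(0)^-1 G_j(n) P_(n+j)(0) Q_x(rho(n+j))
        = sum_j Q_(x+j)(rho(n)) Ups(x+j) F_j(x) Ups(x)^-1
    for all n so large that no index n+j is negative ([dual_relation]): the
    right-hand side is the action of sigma(D), and the left-hand side would be
    that of tau(M) if its coefficients were known to be rational in n.

    Two points need an argument. First, to substitute x one must know that the
    F_j have no pole at x. Since P is monic, D maps every polynomial with
    matrix coefficients to a polynomial; a scalar polynomial vanishing to high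
    order at the points x+k, k <> j, but not at x+j isolates F_j, which is thus
    regular at x ([intertwine_regular]).

    Secondly, the sequences P_n(0)^-1 G_j(n) P_(n+j)(0) must extend rationally.
    By the displayed relation their combinations with the Q_x(rho(n+j)) are
    values of rational functions of n; as Q is monic, so are their combinations
    with the powers rho(n+j)^k. These form a linear system whose matrix is a
    block Vandermonde matrix, rational in n and invertible at all large n, so its
    solution is rational ([rational_of_moments]). Both sides of the relation are
    then rational in n and agree at infinitely many n, hence are equal: tau(M)
    exists and intertwines with sigma(D) ([tau_intertwines]).

    The commutativity of the diagram follows from uniqueness. The coefficients
    of tau(M) are determined by their values ([tau_unique]), and an operator is
    determined by its action on Q because the block Vandermonde matrix is
    invertible over the field of rational functions ([psid_unique]). *)

(** * Values of rational functions *)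

Section RationalValues.
Variable K : numClosedFieldType.
Implicit Types (f g : ratfun K) (p q : {poly K}) (a u v : K).

(** [rat_shift] is defined through the chosen representative of the quotient,
    so its values can only be reached from this presentation of [f]. *)
Lemma ratfun_repr f :
  f = tofrac (frac (repr f)).1 / tofrac (frac (repr f)).2.
Proof.
have d0 := denom_ratioP (repr f).
apply: (mulIf (x := tofrac (frac (repr f)).2)); first by rewrite tofrac_eq0.
rewrite divfK ?tofrac_eq0 // -[X in X * _](reprK f); move: (repr f) d0 => r d0.
rewrite [X in _ * X]/FracField.tofrac [RHS]/FracField.tofrac; unlock.
have := FracField.pi_mul r (Ratio (frac r).2 1); rewrite /= => e.
apply: etrans (esym e) _.
apply/eqmodP; rewrite /= FracField.equivfE /FracField.mulf /=.
by rewrite !numden_Ratio ?(oner_neq0, mulf_neq0, mulr1) // mulrC.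
Qed.

Lemma ratfun_eq p q p' q' : q != 0 -> q' != 0 ->
  (tofrac p / tofrac q == tofrac p' / tofrac q' :> ratfun K) =
  (p * q' == p' * q).
Proof.
by move=> q0 q0'; rewrite eqr_div ?tofrac_eq0 // -!tofracM tofrac_eq.
Qed.

Lemma horner_neq0 q a : q.[a] != 0 -> q != 0.
Proof. by apply: contraNneq => ->; rewrite horner0. Qed.

Lemma rat_at_poly p a : rat_at (tofrac p) a p.[a].
Proof. by exists p, 1; rewrite hornerC oner_eq0 rmorph1 !divr1. Qed.

Lemma rat_at_unique f a u v : rat_at f a u -> rat_at f a v -> u = v.
Proof.
move=> [p [q [qa -> ->]]] [p' [q' [q'a]]] /eqP.
rewrite ratfun_eq ?(horner_neq0 qa) ?(horner_neq0 q'a) // => /eqP e ->.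
by apply/eqP; rewrite eqr_div // -!hornerM e.
Qed.

Lemma rat_evalE f a v : rat_at f a v -> rat_eval f a = v.
Proof.
move=> fv; apply: xget_unique => //= u fu; exact: rat_at_unique fu fv.
Qed.

Lemma rat_atD f g a u v : rat_at f a u -> rat_at g a v -> rat_at (f + g) a (u + v).
Proof.
move=> [p [q [qa -> ->]]] [p' [q' [q'a -> ->]]].
exists (p * q' + p' * q), (q * q'); split.
- by rewrite hornerM mulf_neq0.
- by rewrite addf_div ?tofrac_eq0 ?(horner_neq0 qa, horner_neq0 q'a) //
             tofracD !tofracM.
- by rewrite addf_div // !hornerE.
Qed.

Lemma rat_atM f g a u v : rat_at f a u -> rat_at g a v -> rat_at (f * g) a (u * v).
Proof.
move=> [p [q [qa -> ->]]] [p' [q' [q'a -> ->]]].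
exists (p * p'), (q * q'); split; first by rewrite hornerM mulf_neq0.
- by rewrite mulf_div !tofracM.
- by rewrite mulf_div !hornerM.
Qed.

Lemma rat_atV f a v : v != 0 -> rat_at f a v -> rat_at f^-1 a v^-1.
Proof.
move=> v0 [p [q [qa -> ve]]]; exists q, p; rewrite ve !invf_div; split=> //.
by apply: contraNneq v0; rewrite ve => ->; rewrite mul0r.
Qed.

Lemma rat_atC c a : rat_at (ratC c) a c.
Proof. by rewrite -[X in rat_at _ _ X](hornerC c a); exact: rat_at_poly. Qed.

Lemma rat_at0 a : rat_at (0 : ratfun K) a 0.
Proof. by rewrite -[X in rat_at X]tofrac0 -[X in rat_at _ _ X](horner0 a);
  exact: rat_at_poly. Qed.

Lemma rat_at1 a : rat_at (1 : ratfun K) a 1.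
Proof. by rewrite -[X in rat_at X]tofrac1 -[X in rat_at _ _ X](hornerC 1 a);
  exact: rat_at_poly. Qed.

Lemma rat_atN f a v : rat_at f a v -> rat_at (- f) a (- v).
Proof.
move=> fv; rewrite -mulN1r -[- v]mulN1r; apply: rat_atM fv.
by have := rat_atC (-1) a; rewrite /ratC polyCN tofracN tofrac1.
Qed.

Lemma rat_at_sum (I : Type) (r : seq I) (C : pred I) (F : I -> ratfun K)
    (V : I -> K) a : (forall i, C i -> rat_at (F i) a (V i)) ->
  rat_at (\sum_(i <- r | C i) F i) a (\sum_(i <- r | C i) V i).
Proof.
move=> FV; apply: (big_ind2 (fun f v => rat_at f a v)) => //; first exact: rat_at0.
by move=> *; exact: rat_atD.
Qed.

Lemma rat_at_prod (I : Type) (r : seq I) (C : pred I) (F : I -> ratfun K)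
    (V : I -> K) a : (forall i, C i -> rat_at (F i) a (V i)) ->
  rat_at (\prod_(i <- r | C i) F i) a (\prod_(i <- r | C i) V i).
Proof.
move=> FV; apply: (big_ind2 (fun f v => rat_at f a v)) => //; first exact: rat_at1.
by move=> *; exact: rat_atM.
Qed.

Lemma rat_at_sign f a v (b : nat) : rat_at f a v ->
  rat_at ((-1) ^+ b * f) a ((-1) ^+ b * v).
Proof.
move=> fv; elim: b => [|b IHb]; first by rewrite !expr0 !mul1r.
by rewrite !exprS !mulN1r !mulNr; exact: rat_atN.
Qed.

Lemma rat_at_shift f a (j : int) v :
  rat_at f (a + j%:~R) v -> rat_at (rat_shift f j) a v.
Proof.
have szXD : size ('X + (j%:~R)%:P : {poly K}) = 2 by rewrite size_XaddC.
have d0 := denom_ratioP (repr f).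
move=> [p [q [qa fE ->]]]; exists (p \Po ('X + (j%:~R)%:P)), (q \Po ('X + (j%:~R)%:P)).
rewrite !horner_comp !hornerE; split=> //.
apply/eqP; rewrite ratfun_eq ?(comp_poly2_eq0 _ szXD) ?(horner_neq0 qa) //.
rewrite -!comp_polyM; apply/eqP; congr (_ \Po _); apply/eqP.
by rewrite -ratfun_eq ?(horner_neq0 qa) // -ratfun_repr fE.
Qed.

(** A nonzero rational function has finitely many zeros, so it is determined by
    its values at the large natural numbers. *)
Lemma rat_at_eventually_inj f g (t : nat) (v : nat -> K) :
  (forall n, (t <= n)%N -> rat_at f n%:R (v n)) ->
  (forall n, (t <= n)%N -> rat_at g n%:R (v n)) -> f = g.
Proof.
move=> fv gv; apply/eqP; rewrite -subr_eq0 (ratfun_repr (f - g)) mulf_eq0.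
apply/orP; left; rewrite tofrac_eq0; set h := f - g; set p := (frac _).1.
have h0 n : (t <= n)%N -> rat_at h n%:R 0.
  by move=> tn; rewrite -(subrr (v n)); apply: rat_atD (fv _ tn) (rat_atN (gv _ tn)).
apply/negPn/negP => p0.
pose rs := [seq (n%:R : K) | n <- iota t (size p)].
have /max_poly_roots : all (root p) rs.
  apply/allP => x /mapP[n]; rewrite mem_iota => /andP[tn _] -> {x}.
  have [p' [q' [q'n hE p'n]]] := h0 n tn; move/esym/eqP: p'n.
  rewrite mulf_eq0 invr_eq0 (negPf q'n) orbF => /eqP p'n.
  have d0 := denom_ratioP (repr h).
  have := ratfun_repr h; rewrite [h in LHS]hE => /eqP.
  rewrite ratfun_eq ?(horner_neq0 q'n) //.
  move=> /eqP /(congr1 (fun s => s.[n%:R])); rewrite !hornerM p'n mul0r => /esym/eqP.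
  by rewrite mulf_eq0 (negPf q'n) orbF.
move=> /(_ p0); rewrite map_inj_uniq ?iota_uniq; last first.
  by move=> x y /eqP; rewrite eqr_nat => /eqP.
by move=> /(_ isT); rewrite size_map size_iota ltnn.
Qed.

(** The order is a threshold, not an exact exponent, so that one exponent can
    serve finitely many rational functions at once. *)
Lemma rat_pole_order f a :
  exists m, forall k, (m <= k)%N -> exists v, rat_at (tofrac (('X - a%:P) ^+ k) * f) a v.
Proof.
have d0 := denom_ratioP (repr f).
have [m [q /implyP/(_ d0) qa dE]] := multiplicity_XsubC (frac (repr f)).2 a.
exists m => k mk; set p := (frac (repr f)).1 in d0 qa dE *.
exists ((('X - a%:P) ^+ (k - m) * p).[a] / q.[a]).
exists (('X - a%:P) ^+ (k - m) * p), q; split => //.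
rewrite (ratfun_repr f) mulrA -tofracM; apply/eqP.
rewrite ratfun_eq // ?(horner_neq0 qa) //.
rewrite dE -[in X in X == _](subnK mk) exprD; apply/eqP; rewrite -/p; ring.
Qed.

End RationalValues.

(** * Values of matrices of rational functions *)

Section MatrixValues.
Variable K : numClosedFieldType.

(** For square matrices of size [N.+1] this is convertible to [rmx_at]; general
    shapes are needed for the block matrices below. *)
Definition mat_at m n (F : 'M[ratfun K]_(m, n)) (a : K) (V : 'M[K]_(m, n)) : Prop :=
  forall i j, rat_at (F i j) a (V i j).

Lemma mat_at_unique m n (F : 'M[ratfun K]_(m, n)) a U V :
  mat_at F a U -> mat_at F a V -> U = V.
Proof. by move=> FU FV; apply/matrixP => i j; exact: rat_at_unique (FU i j) (FV i j). Qed.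

Lemma mat_at_eventually_inj m n (F G : 'M[ratfun K]_(m, n)) (t : nat)
    (V : nat -> 'M[K]_(m, n)) :
  (forall k, (t <= k)%N -> mat_at F k%:R (V k)) ->
  (forall k, (t <= k)%N -> mat_at G k%:R (V k)) -> F = G.
Proof.
move=> FV GV; apply/matrixP => i j.
by apply: (rat_at_eventually_inj (t := t) (v := fun k => V k i j)) => k tk;
  [exact: FV | exact: GV].
Qed.

Lemma mat_at_mul m n p (F : 'M[ratfun K]_(m, n)) (G : 'M[ratfun K]_(n, p)) a U V :
  mat_at F a U -> mat_at G a V -> mat_at (F *m G) a (U *m V).
Proof.
by move=> FU GV i j; rewrite !mxE; apply: rat_at_sum => k _; exact: rat_atM.
Qed.

Lemma rat_at_det n (F : 'M[ratfun K]_n) a V : mat_at F a V -> rat_at (\det F) a (\det V).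
Proof.
move=> FV; apply: rat_at_sum => s _; apply: rat_at_sign.
by apply: rat_at_prod.
Qed.

(** The determinant of [F] takes a nonzero value, hence is not zero. *)
Lemma mat_at_unitmx n (F : 'M[ratfun K]_n) a V :
  mat_at F a V -> V \in unitmx -> F \in unitmx.
Proof.
move=> FV; rewrite !unitmxE !unitfE; apply: contraNneq => dF.
by have := rat_at_det FV; rewrite dF => /(rat_at_unique (rat_at0 a)) <-.
Qed.

(** By Cramer's rule the only denominator introduced by the inversion is the
    determinant, which does not vanish at [a]. *)
Lemma mat_at_inv_regular n (F : 'M[ratfun K]_n) a V :
  mat_at F a V -> V \in unitmx -> exists C, mat_at (invmx F) a C.
Proof.
move=> FV Vu; exists (invmx V) => i j.
rewrite /invmx Vu (mat_at_unitmx FV Vu) !mxE; apply: rat_atM.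
  by apply: rat_atV (rat_at_det FV); rewrite -unitfE -unitmxE.
apply: rat_at_sign; apply: rat_at_det => k l; rewrite !mxE; exact: FV.
Qed.

Lemma mat_at_mxblock p q (r : 'I_p -> nat) (s : 'I_q -> nat)
    (F : forall i j, 'M[ratfun K]_(r i, s j)) a V :
  (forall i j, mat_at (F i j) a (V i j)) ->
  mat_at (\mxblock_(i, j) F i j) a (\mxblock_(i, j) V i j).
Proof. by move=> FV i j; rewrite !mxE; exact: FV. Qed.

Lemma mat_at_mxrow m q (s : 'I_q -> nat)
    (F : forall j, 'M[ratfun K]_(m, s j)) a V :
  (forall j, mat_at (F j) a (V j)) -> mat_at (\mxrow_j F j) a (\mxrow_j V j).
Proof. by move=> FV i j; rewrite !mxE; exact: FV. Qed.

Lemma mat_at_submxrow m q (s : 'I_q -> nat) (F : 'M[ratfun K]_(m, \sum_i s i)) a V j :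
  mat_at F a V -> mat_at (submxrow F j) a (submxrow V j).
Proof. by move=> FV i k; rewrite !mxE; exact: FV. Qed.

End MatrixValues.

(** * Matrix polynomials *)

Section LeftEvaluation.
Variable S : nzRingType.
Implicit Types p q : {poly S}.

Lemma leval_wide n p a : (size p <= n)%N -> leval p a = \sum_(k < n) a ^+ k * p`_k.
Proof.
move=> pn; rewrite /leval.
rewrite (big_ord_widen_cond n (fun=> true) (fun k => a ^+ k * p`_k)) //=.
rewrite big_mkcond; apply: eq_bigr => k _.
by case: ltnP => // /(nth_default 0) ->; rewrite mulr0.
Qed.

Lemma leval0 (a : S) : leval 0 a = 0.
Proof. by rewrite /leval size_poly0 big_ord0. Qed.

Lemma levalD p q a : leval (p + q) a = leval p a + leval q a.
Proof.
rewrite !(@leval_wide (maxn (size p) (size q))) ?leq_maxl ?leq_maxr //.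
  by rewrite -big_split; apply: eq_bigr => k _; rewrite coefD mulrDr.
exact: size_polyD.
Qed.

Lemma levalMC p c a : leval (p * c%:P) a = leval p a * c.
Proof.
rewrite !(@leval_wide (size p)) //.
  by rewrite mulr_suml; apply: eq_bigr => k _; rewrite coefMC mulrA.
apply/leq_sizeP => j /(nth_default 0) pj; by rewrite coefMC pj mul0r.
Qed.

Lemma leval_Xn k (a : S) : leval 'X^k a = a ^+ k.
Proof.
rewrite (@leval_wide k.+1) ?size_polyXn // big_ord_recr /= coefXn eqxx mulr1.
by rewrite big1 ?add0r // => i _; rewrite coefXn ltn_eqF ?mulr0.
Qed.

(** A property of polynomials stable under sums holds for all of them as soon as
    every monomial can be corrected to lower degree by a polynomial having it. *)
Lemma poly_leading_ind (T : {poly S} -> Prop) :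
  T 0 -> (forall p q, T p -> T q -> T (p + q)) ->
  (forall c n, exists2 q, T q & (size q <= n.+1)%N /\ q`_n = c) ->
  forall p, T p.
Proof.
move=> T0 TD Tlead p; have [n] := ubnP (size p); elim: n p => // n IHn p.
rewrite ltnS leq_eqVlt => /orP[/eqP pn|]; last exact: IHn.
case: n pn IHn => [|n] pn IHn; first by move/eqP: pn; rewrite size_poly_eq0 => /eqP ->.
have [q Tq [qn qc]] := Tlead p`_n n.
rewrite -(subrK q p); apply: TD => //; apply: IHn; rewrite ltnS.
apply/leq_sizeP => j; rewrite leq_eqVlt => /orP[/eqP <-|nj].
  by rewrite coefB qc subrr.
by rewrite coefB !nth_default ?subr0 // ?pn // (leq_trans qn).
Qed.

End LeftEvaluation.

Section MonicBasis.
Variables (K : numClosedFieldType) (N : nat).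
Local Notation mx := 'M[K]_N.+1.
Variable Q : nat -> {poly mx}.
Hypothesis Q_monic : monic_seq Q.

Lemma monic_seq_coef n : (Q n)`_n = 1.
Proof. by have [/monicP <- sQ] := Q_monic n; rewrite lead_coefE sQ. Qed.

(** A monic sequence is a basis of the polynomials both as a left and as a right
    module over the matrices. The left version serves the family [P], evaluated
    with the variable on the right; the right version serves [Q], evaluated with
    the variable on the left. *)
Lemma monic_seq_left_ind (T : {poly mx} -> Prop) :
  T 0 -> (forall p q, T p -> T q -> T (p + q)) ->
  (forall c n, T (c%:P * Q n)) -> forall p, T p.
Proof.
move=> T0 TD TQ; apply: poly_leading_ind => // c n.
exists (c%:P * Q n) => //; rewrite coefCM monic_seq_coef mulr1; split=> //.
apply/leq_sizeP => j nj; rewrite coefCM nth_default ?mulr0 //.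
by have [_ ->] := Q_monic n.
Qed.

Lemma monic_seq_right_ind (T : {poly mx} -> Prop) :
  T 0 -> (forall p q, T p -> T q -> T (p + q)) ->
  (forall c n, T (Q n * c%:P)) -> forall p, T p.
Proof.
move=> T0 TD TQ; apply: poly_leading_ind => // c n.
exists (Q n * c%:P) => //; rewrite coefMC monic_seq_coef mul1r; split=> //.
apply/leq_sizeP => j nj; rewrite coefMC nth_default ?mul0r //.
by have [_ ->] := Q_monic n.
Qed.

End MonicBasis.

(** * Polynomials evaluated at matrices of rational functions *)

Section RationalMatrices.
Variables (K : numClosedFieldType) (N : nat).
Local Notation mx := 'M[K]_N.+1.
Local Notation rm := 'M[ratfun K]_N.+1.
Implicit Types (F G : rm) (U V c : mx) (a : K) (p : {poly mx}).

Lemma rmx_at_unique F a U V : rmx_at F a U -> rmx_at F a V -> U = V.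
Proof. exact: mat_at_unique. Qed.

Lemma rmx_evalE F (n : nat) V : rmx_at F n%:R V -> rmx_eval F n = V.
Proof. by move=> FV; apply/matrixP => i j; rewrite mxE; exact: rat_evalE (FV i j). Qed.

Lemma rmx_at_eval F n : (exists V, rmx_at F n%:R V) -> rmx_at F n%:R (rmx_eval F n).
Proof. by case=> V FV; rewrite (rmx_evalE FV). Qed.

Lemma rmx_at0 a : rmx_at (0 : rm) a 0.
Proof. by move=> i j; rewrite !mxE; exact: rat_at0. Qed.

Lemma rmx_at1 a : rmx_at (1 : rm) a 1.
Proof. by move=> i j; rewrite !mxE; case: eqP => _; [exact: rat_at1|exact: rat_at0]. Qed.

Lemma rmx_atD F G a U V : rmx_at F a U -> rmx_at G a V -> rmx_at (F + G) a (U + V).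
Proof. by move=> FU GV i j; rewrite !mxE; exact: rat_atD. Qed.

Lemma rmx_atM F G a U V : rmx_at F a U -> rmx_at G a V -> rmx_at (F * G) a (U * V).
Proof. exact: mat_at_mul. Qed.

Lemma rmx_atC c a : rmx_at (rmxC c) a c.
Proof. by move=> i j; rewrite !mxE; exact: rat_atC. Qed.

Lemma rmx_atX F a V k : rmx_at F a V -> rmx_at (F ^+ k) a (V ^+ k).
Proof.
move=> FV; elim: k => [|k IHk]; first exact: rmx_at1.
by rewrite !exprS; exact: rmx_atM.
Qed.

Lemma rmx_at_sum (I : Type) (r : seq I) (C : pred I) (F : I -> rm)
    (V : I -> mx) a : (forall i, C i -> rmx_at (F i) a (V i)) ->
  rmx_at (\sum_(i <- r | C i) F i) a (\sum_(i <- r | C i) V i).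
Proof.
move=> FV; apply: (big_ind2 (fun f v => rmx_at f a v)) => //; first exact: rmx_at0.
by move=> *; exact: rmx_atD.
Qed.

Lemma rmx_at_scalar (f : ratfun K) a v : rat_at f a v -> rmx_at (f%:M : rm) a v%:M.
Proof. by move=> fv i j; rewrite !mxE; case: eqP => _ //=; exact: rat_at0. Qed.

(** The target point is kept as a natural number [m], since [rho] is only
    known to be regular at natural numbers. *)
Lemma rmx_at_shift F (j : int) (n m : nat) V : n%:Z + j = m%:Z ->
  rmx_at F m%:R V -> rmx_at (rmx_shift F j) n%:R V.
Proof.
move=> nj FV i k; rewrite mxE; apply: rat_at_shift.
suff -> : n%:R + j%:~R = m%:R :> K by exact: FV.
by rewrite !pmulrn -intrD nj.
Qed.

Lemma rmxC_is_zmod : zmod_morphism (@rmxC K N).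
Proof. by move=> A B; apply/matrixP => i j; rewrite !mxE /ratC polyCB tofracB. Qed.

Lemma rmxC_is_monoid : monoid_morphism (@rmxC K N).
Proof.
split=> [|A B]; apply/matrixP => i j; rewrite !mxE.
  by case: eqP => _; rewrite /ratC ?polyC1 ?polyC0 ?tofrac1 ?tofrac0.
by rewrite /ratC !rmorph_sum; apply: eq_bigr => k _; rewrite !mxE !rmorphM.
Qed.

HB.instance Definition _ := GRing.isZmodMorphism.Build _ _ (@rmxC K N) rmxC_is_zmod.
HB.instance Definition _ := GRing.isMonoidMorphism.Build _ _ (@rmxC K N) rmxC_is_monoid.

Lemma rpolyD p q : rpoly (p + q) = rpoly p + rpoly q.
Proof. exact: rmorphD. Qed.

Lemma rpoly0 : rpoly (0 : {poly mx}) = 0.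
Proof. exact: rmorph0. Qed.

Lemma rpolyM p q : rpoly (p * q) = rpoly p * rpoly q.
Proof. exact: rmorphM. Qed.

Lemma rpolyC c : rpoly c%:P = (rmxC c)%:P.
Proof. exact: map_polyC. Qed.

Lemma rpolyXn k : rpoly ('X^k : {poly mx}) = 'X^k.
Proof. exact: map_polyXn. Qed.

Lemma size_rpoly p : (size (rpoly p) <= size p)%N.
Proof. exact: size_poly. Qed.

Lemma rmx_at_leval p F a V : rmx_at F a V -> rmx_at (leval (rpoly p) F) a (leval p V).
Proof.
move=> FV; rewrite !(@leval_wide _ (size p)) ?size_rpoly //.
apply: rmx_at_sum => k _; rewrite coef_map /=.
by apply: rmx_atM; [exact: rmx_atX | exact: rmx_atC].
Qed.

Lemma rmx_at_horner p F a V : rmx_at F a V -> rmx_at (rpoly p).[F] a p.[V].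
Proof.
move=> FV; rewrite !(@horner_coef_wide _ (size p)) ?size_rpoly //.
apply: rmx_at_sum => k _; rewrite coef_map /=.
by apply: rmx_atM; [exact: rmx_atC | exact: rmx_atX].
Qed.

Lemma rmx_at_XD (j : int) a : rmx_at ((ratXD K j)%:M : rm) a (a + j%:~R)%:M.
Proof.
apply: rmx_at_scalar; have := rat_at_poly ('X + (j%:~R)%:P) a.
by rewrite !hornerE.
Qed.

End RationalMatrices.

(** * Regularity of intertwined operators *)

Section Regularity.
Variables (K : numClosedFieldType) (N : nat).
Local Notation mx := 'M[K]_N.+1.
Local Notation rm := 'M[ratfun K]_N.+1.

Definition regular_at (F : rm) (a : K) : Prop := exists V, rmx_at F a V.

Lemma eventually_uniform (I : eqType) (s : seq I) (T : I -> nat -> Prop) :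
  (forall i, exists m, forall k, (m <= k)%N -> T i k) ->
  exists m, forall i, i \in s -> forall k, (m <= k)%N -> T i k.
Proof.
move=> ev; elim: s => [|i s [m IHm]]; first by exists 0%N.
have [l Tl] := ev i; exists (maxn l m) => j; rewrite inE => /orP[/eqP ->|js] k.
  by rewrite geq_max => /andP[lk _]; exact: Tl.
by rewrite geq_max => /andP[_ mk]; exact: IHm.
Qed.

Lemma rmx_at_scale (f : ratfun K) (F : rm) a v V :
  rat_at f a v -> rmx_at F a V -> rmx_at (f *: F) a (v *: V).
Proof. by move=> fv FV i j; rewrite !mxE; exact: rat_atM. Qed.

Lemma regular_entries (F : rm) a :
  (forall i j, exists v, rat_at (F i j) a v) -> regular_at F a.
Proof.
move=> H; have /choice[V HV] : forall i, exists V, forall j, rat_at (F i j) a (V j).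
  by move=> i; have [V HV] := choice (H i); exists V.
by exists (\matrix_(i, j) V i j) => i j; rewrite mxE.
Qed.

Lemma rmx_pole_order (F : rm) a :
  exists m, forall k, (m <= k)%N -> regular_at (tofrac (('X - a%:P) ^+ k) *: F) a.
Proof.
have [m Hm] := eventually_uniform (enum {: 'I_N.+1 * 'I_N.+1})
  (fun ij => rat_pole_order (F ij.1 ij.2) a).
exists m => k mk; apply: regular_entries => i j; rewrite mxE.
by apply: (Hm (i, j)); rewrite ?mem_enum.
Qed.

(** Scalar polynomials act on each coefficient of an operator by scalar
    multiplication, which lets a well chosen one cancel poles. *)
Lemma rpoly_scalar_horner (g : {poly K}) (j : int) :
  (rpoly (map_poly (@scalar_mx K N.+1) g)).[(ratXD K j)%:M] =
  (tofrac (g \Po ('X + (j%:~R)%:P)))%:M.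
Proof.
rewrite (@horner_coef_wide _ (size g)); last first.
  by apply: leq_trans (size_rpoly _) _; exact: size_poly.
rewrite comp_polyE !rmorph_sum; apply: eq_bigr => k _.
rewrite coef_map /= coef_map /= -mul_polyC !rmorphM !rmorphXn /=; congr (_ * _).
apply/matrixP => i l; rewrite !mxE; case: eqP => _ //.
Qed.

(** [right_act] with an arbitrary polynomial in place of the members of [P]. *)
Definition poly_act (D : MN K N) (p : {poly mx}) : rm :=
  \sum_(j <- finsupp D) (rpoly p).[(ratXD K j)%:M] * D j.

(** The action is linear over left constants and the members of [P] are sent to
    polynomials by the intertwining relation, and they span everything. *)
Lemma poly_act_regular (P : nat -> {poly mx}) (M : NN K N) (D : MN K N) :
  monic_seq P -> intertwine P M D -> forall p a, regular_at (poly_act D p) a.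
Proof.
move=> mP MD p a; elim/(monic_seq_left_ind mP): p => [|p q [U pU] [V qV]|c n].
- exists 0; rewrite /poly_act big1; first exact: rmx_at0.
  by move=> j _; rewrite rpoly0 horner0 mul0r.
- exists (U + V); have := rmx_atD pU qV; rewrite /poly_act -big_split /=.
  by under eq_bigr do rewrite -mulrDl -hornerD -rpolyD.
- suff [V HV] : regular_at (poly_act D (P n)) a.
    exists (c * V); rewrite /poly_act.
    under eq_bigr do rewrite rpolyM rpolyC hornerCM -mulrA.
    by rewrite -mulr_sumr; apply: rmx_atM HV; exact: rmx_atC.
  rewrite -[poly_act _ _]/(right_act P D n) -MD.
  eexists; apply: rmx_at_sum => j _; apply: rmx_atM; first exact: rmx_atC.
  apply: rmx_at_horner; exact: rmx_at_XD.
Qed.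

(** Apply [D] to a scalar polynomial [g] that kills at [a] the poles of all
    coefficients other than [D j], and does not vanish at [a + j]: the term of
    index [j] is then regular at [a], and [g (a + j)] can be divided out. *)
Lemma intertwine_regular (P : nat -> {poly mx}) (M : NN K N) (D : MN K N) :
  monic_seq P -> intertwine P M D -> forall j a, regular_at (D j) a.
Proof.
move=> mP MD j a; have [jD|jD] := boolP (j \in finsupp D); last first.
  by rewrite (fsfun_dflt jD); exists 0; exact: rmx_at0.
have [m Hm] := eventually_uniform (finsupp D) (fun k => rmx_pole_order (D k) a).
(* m bounds the pole orders at a of all coefficients; the factor of index k
   becomes ('X - a) ^ m once composed with 'X + k. *)
pose g : {poly K} :=
  \prod_(k <- finsupp D | k != j) ('X - (a + k%:~R)%:P) ^+ m.
have compg (l : int) : g \Po ('X + (l%:~R)%:P) =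
    \prod_(k <- finsupp D | k != j) ('X + (l%:~R)%:P - (a + k%:~R)%:P) ^+ m.
  rewrite rmorph_prod; apply: eq_bigr => k _.
  by rewrite rmorphXn /= comp_polyB comp_polyX comp_polyC.
have gj : (g \Po ('X + (j%:~R)%:P)).[a] != 0.
  rewrite compg horner_prod prodf_seq_neq0; apply/allP => k _; apply/implyP => kj.
  rewrite !hornerE expf_neq0 // opprD addrACA subrr add0r subr_eq0 eqr_int.
  by rewrite eq_sym.
have [V HV] := poly_act_regular mP MD (map_poly (@scalar_mx K N.+1) g) a.
have actE : poly_act D (map_poly (@scalar_mx K N.+1) g) =
    \sum_(k <- finsupp D) tofrac (g \Po ('X + (k%:~R)%:P)) *: D k.
  by apply: eq_bigr => k _; rewrite rpoly_scalar_horner; exact: mul_scalar_mx.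
have [U HU] : regular_at (\sum_(k <- finsupp D | k != j)
    tofrac (g \Po ('X + (k%:~R)%:P)) *: D k) a.
  have term k : exists U, (k \in finsupp D) && (k != j) ->
      rmx_at (tofrac (g \Po ('X + (k%:~R)%:P)) *: D k) a U.
    have [/andP[kD kj]|_] := boolP ((k \in finsupp D) && (k != j)); last by exists 0.
    have [U HU] := Hm k kD m (leqnn m).
    rewrite compg -big_filter (bigD1_seq k) ?mem_filter ?kj ?filter_uniq ?fset_uniq //=.
    set h := \prod_(_ <- _ | _) _; exists (h.[a] *: U) => _.
    rewrite mulrC tofracM -scalerA; apply: rmx_at_scale; first exact: rat_at_poly.
    suff -> : 'X + (k%:~R)%:P - (a + k%:~R)%:P = 'X - a%:P :> {poly K} by [].
    by rewrite polyCD opprD addrACA subrr addr0.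
  have [U HU] := choice term.
  exists (\sum_(k <- finsupp D | (k \in finsupp D) && (k != j)) U k).
  by rewrite big_seq_cond; exact: rmx_at_sum.
rewrite actE (bigD1_seq j) ?fset_uniq //= in HV.
apply: regular_entries => i l; exists ((g \Po ('X + (j%:~R)%:P)).[a]^-1 * (V - U) i l).
have g0 : tofrac (g \Po ('X + (j%:~R)%:P)) != 0 :> ratfun K.
  by rewrite tofrac_eq0 (horner_neq0 gj).
(* V - U is the value at a of the term of index j *)
rewrite -[D j i l](mulKf g0); apply: rat_atM.
  by apply: rat_atV => //; exact: rat_at_poly.
have := rat_atD (HV i l) (rat_atN (HU i l)); rewrite !mxE.
by rewrite addrK.
Qed.

End Regularity.

(** * Finite windows of shifts *)

Lemma eq_big_seq_supp (V : zmodType) (I : eqType) (r s : seq I) (F : I -> V) :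
  uniq r -> uniq s -> (forall j, j \notin r -> F j = 0) ->
  (forall j, j \notin s -> F j = 0) ->
  \sum_(j <- r) F j = \sum_(j <- s) F j.
Proof.
move=> ur us Fr Fs; apply: perm_big_supp; apply: uniq_perm; rewrite ?filter_uniq //.
move=> j; rewrite !mem_filter; have [//|Fj /=] := eqVneq (F j) 0.
have -> : j \in r by apply: contraNT Fj => /Fr ->.
by apply/esym; apply: contraNT Fj => /Fs ->.
Qed.

(** The integers from [-t] to [m - t]. Reindexing an operator supported there by
    [i < m.+1] makes its action at [n] involve [rho (n - t + i)], the consecutive
    points on which the block Vandermonde matrix is invertible. *)
Definition window (t m : nat) : seq int := [seq i%:Z - t%:Z | i <- iota 0 m.+1].

Lemma mem_window t m j : (j \in window t m) = (0 <= t%:Z + j <= m%:Z).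
Proof.
apply/mapP/idP => [[l]|/andP[j0 jm]]; first by rewrite mem_iota => ? ->; lia.
by exists (absz (t%:Z + j)); [rewrite mem_iota; lia | lia].
Qed.

Lemma window_uniq t m : uniq (window t m).
Proof. by rewrite map_inj_uniq ?iota_uniq // => i k; lia. Qed.

Lemma big_window (V : zmodType) (s : seq int) t m (F : int -> V) :
  uniq s -> {subset s <= window t m} -> (forall j, j \notin s -> F j = 0) ->
  \sum_(j <- s) F j = \sum_(i < m.+1) F (i%:Z - t%:Z).
Proof.
move=> us sw Fs; rewrite (eq_big_seq_supp us (window_uniq t m)) //; last first.
  by move=> j jw; apply: Fs; apply: contraNN jw; exact: sw.
by rewrite big_map -(big_mkord xpredT (fun i => F (i%:Z - t%:Z))).
Qed.

(** The second clause makes [t] minimal: [t <= n] is then the exact condition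
    under which [is_tau] prescribes values at [n]. *)
Lemma exists_window (s : seq int) : exists t m,
  {subset s <= window t m} /\
  forall n : nat, (t <= n)%N <-> (forall k, k \in s -> 0 <= n%:Z + k).
Proof.
pose B := \max_(k <- s) `|k|%N.
have leB k : k \in s -> (`|k| <= B)%N by move=> ks; exact: leq_bigmax_seq.
have exn : exists n : nat, all (fun k => 0 <= n%:Z + k) s.
  by exists B; apply/allP => k /leB; lia.
case: (ex_minnP exn) => t /allP tP tmin; exists t, (t + B)%N; split.
  by move=> k ks; rewrite mem_window; have := leB k ks; have := tP k ks; lia.
move=> n; split=> [tn k /tP|np]; first by lia.
by apply: tmin; apply/allP.
Qed.

(** * Block Vandermonde systems *)

Section Vandermonde.
Variables (K : numClosedFieldType) (N : nat).
Local Notation mx := 'M[K]_N.+1.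
Local Notation rm := 'M[ratfun K]_N.+1.
Variable rho : rm.
Hypothesis rho_regular : rmx_regular rho.
Hypothesis rho_vandermonde : forall nu x : nat,
  (\mxblock_(i < x.+1, j < x.+1)
    ((rmx_eval rho (nu + i)) ^+ j : 'M[K]_(N.+1, N.+1))) \in unitmx.

Lemma rmx_at_rho_shift (t i n : nat) : (t <= n)%N ->
  rmx_at (rmx_shift rho (i%:Z - t%:Z)) n%:R (rmx_eval rho (n - t + i)).
Proof.
move=> tn; apply: (@rmx_at_shift _ _ _ _ _ (n - t + i)%N); first by lia.
exact/rmx_at_eval/rho_regular.
Qed.

Definition shift_vandermonde (t m : nat) :=
  \mxblock_(i < m.+1, k < m.+1)
    ((rmx_shift rho (i%:Z - t%:Z)) ^+ k : 'M[ratfun K]_(N.+1, N.+1)).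

Lemma shift_vandermonde_at (t m n : nat) : (t <= n)%N ->
  mat_at (shift_vandermonde t m) n%:R
    (\mxblock_(i < m.+1, k < m.+1)
      ((rmx_eval rho (n - t + i)) ^+ k : 'M[K]_(N.+1, N.+1))).
Proof.
move=> tn; apply: mat_at_mxblock => i k.
exact: rmx_atX (rmx_at_rho_shift _ tn).
Qed.

Lemma shift_vandermonde_unit (t m : nat) : shift_vandermonde t m \in unitmx.
Proof.
apply: mat_at_unitmx (shift_vandermonde_at (leqnn t)) _.
exact: (rho_vandermonde (t - t) m).
Qed.

(** The rational candidate is the solution [X] over the field of rational
    functions of the linear system defined by the first [m.+1] moments. At
    [n >= t] it is regular, and both its value and the row of the [g i n] solve
    the system evaluated at [n], whose matrix is invertible. *)
Lemma rational_of_moments (t m : nat) (g : 'I_m.+1 -> nat -> mx) :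
  (forall k : nat, exists L : rm, forall n, (t <= n)%N ->
    rmx_at L n%:R (\sum_i g i n * rmx_eval rho (n - t + i) ^+ k)) ->
  exists G : 'I_m.+1 -> rm, forall i n, (t <= n)%N -> rmx_at (G i) n%:R (g i n).
Proof.
move=> /choice[L HL]; pose B := shift_vandermonde t m.
pose X := \mxrow_(k < m.+1) (L k : 'M[ratfun K]_(N.+1, N.+1)) *m invmx B.
exists (fun i => submxrow X i) => i n tn.
pose V := \mxblock_(i < m.+1, k < m.+1)
      ((rmx_eval rho (n - t + i)) ^+ k : 'M[K]_(N.+1, N.+1)).
have BV : mat_at B n%:R V := shift_vandermonde_at tn.
have Vu : V \in unitmx := rho_vandermonde _ _.
have [C BC] := mat_at_inv_regular BV Vu.
pose gr := \mxrow_(i < m.+1) (g i n : 'M[K]_(N.+1, N.+1)).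
have LV : mat_at (\mxrow_(k < m.+1) (L k : 'M[ratfun K]_(N.+1, N.+1))) n%:R (gr *m V).
  by rewrite mul_mxrow_mxblock; apply: mat_at_mxrow => k; exact: HL.
have XV : mat_at X n%:R (gr *m V *m C) := mat_at_mul LV BC.
(* C is not identified as the inverse of V: it cancels in X *m B. *)
have XBV := mat_at_mul XV BV.
rewrite mulmxKV ?shift_vandermonde_unit // in XBV.
have /(congr1 (mulmx^~ (invmx V))) := mat_at_unique XBV LV.
rewrite !mulmxK // => XgE; rewrite XgE in XV.
rewrite -[g i n](mxrowK (fun i => g i n)); exact: mat_at_submxrow.
Qed.

Lemma shift_moments_inj (t m : nat) (G : 'I_m.+1 -> rm) :
  (forall k : nat, \sum_i G i * rmx_shift rho (i%:Z - t%:Z) ^+ k = 0) ->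
  forall i, G i = 0.
Proof.
move=> G0 i; rewrite -[G i](mxrowK (fun i => G i : 'M[ratfun K]_(N.+1, N.+1))).
suff -> : \mxrow_i (G i : 'M[ratfun K]_(N.+1, N.+1)) = 0 by rewrite submxrow0.
rewrite -[LHS](mulmxK (shift_vandermonde_unit t m)) mul_mxrow_mxblock.
suff -> : \mxrow_(j < m.+1) \sum_i G i *m
    (rmx_shift rho (i%:Z - t%:Z) ^+ j : 'M[ratfun K]_(N.+1, N.+1)) = 0.
  by rewrite mul0mx.
by apply/mxrowP => k; rewrite mxrowK submxrow0; exact: G0.
Qed.

Variables (Q : nat -> {poly mx}).
Hypothesis Q_monic : monic_seq Q.

(** The polynomials [p] for which the combination of the [p (rho (n - t + i))]
    is rational in [n] form a right module, so the powers may be replaced by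
    any monic sequence. *)
Lemma rational_of_dual_moments (t m : nat) (g : 'I_m.+1 -> nat -> mx) :
  (forall x : nat, exists L : rm, forall n, (t <= n)%N ->
    rmx_at L n%:R (\sum_i g i n * leval (Q x) (rmx_eval rho (n - t + i)))) ->
  exists G : 'I_m.+1 -> rm, forall i n, (t <= n)%N -> rmx_at (G i) n%:R (g i n).
Proof.
move=> HQ; apply: rational_of_moments => k.
suff [L HL] : exists L : rm, forall n, (t <= n)%N ->
    rmx_at L n%:R (\sum_i g i n * leval 'X^k (rmx_eval rho (n - t + i))).
  by exists L => n /HL; under eq_bigr do rewrite leval_Xn.
elim/(monic_seq_right_ind Q_monic): 'X^k => [|p q [F HF] [G HG]|c x].
- exists 0 => n _; rewrite big1; first exact: rmx_at0.
  by move=> i _; rewrite leval0 mulr0.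
- exists (F + G) => n tn; have := rmx_atD (HF n tn) (HG n tn).
  by rewrite -big_split /=; under eq_bigr do rewrite -mulrDr -levalD.
- have [L HL] := HQ x; exists (L * rmxC c) => n tn.
  have := rmx_atM (HL n tn) (rmx_atC c n%:R).
  by rewrite mulr_suml; under eq_bigr do rewrite -mulrA -levalMC.
Qed.

Lemma dual_moments_inj (t m : nat) (G : 'I_m.+1 -> rm) :
  (forall x : nat,
    \sum_i G i * leval (rpoly (Q x)) (rmx_shift rho (i%:Z - t%:Z)) = 0) ->
  forall i, G i = 0.
Proof.
move=> HQ; apply: (@shift_moments_inj t) => k.
suff : \sum_i G i * leval (rpoly 'X^k) (rmx_shift rho (i%:Z - t%:Z)) = 0.
  by under eq_bigr do rewrite rpolyXn leval_Xn.
elim/(monic_seq_right_ind Q_monic): 'X^k => [|p q p0 q0|c x].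
- by rewrite big1 // => i _; rewrite rpoly0 leval0 mulr0.
- under eq_bigr do rewrite rpolyD levalD mulrDr.
  by rewrite big_split /= p0 q0 addr0.
- under eq_bigr do rewrite rpolyM rpolyC levalMC mulrA.
  by rewrite -mulr_suml HQ mul0r.
Qed.

End Vandermonde.

(** * The dual intertwining relation *)

Section Dual.
Variables (K : numClosedFieldType) (N : nat).
Local Notation mx := 'M[K]_N.+1.
Local Notation rm := 'M[ratfun K]_N.+1.
Variables (W : int -> mx) (P : nat -> {poly mx}).
Variables (rho : rm) (Ups : nat -> mx) (Q : nat -> {poly mx}).
Hypothesis P_monic : monic_seq P.
Hypothesis dual : is_dual_family W P rho Ups Q.

(** Each coefficient is prescribed at all large natural numbers. *)
Lemma tau_unique (M : NN K N) (G G' : NdN K N) :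
  is_tau P M G -> is_tau P M G' -> G = G'.
Proof.
move=> HG HG'; apply/fsfunP => j.
have [t [m [_ tP]]] := exists_window (finsupp M).
apply: (@mat_at_eventually_inj _ _ _ _ _ t
  (fun n => (P n).[0]^-1 * M j n * (ext0 P (n%:Z + j)).[0])) => n /tP np.
  exact: HG.
exact: HG'.
Qed.

(** Two solutions supported in a common window have a difference that
    annihilates all the [Q x], hence all powers of the shifted [rho]. *)
Lemma psid_unique (D : MdN K N) (G G' : NdN K N) :
  dintertwine rho Q D G -> dintertwine rho Q D G' -> G = G'.
Proof.
move=> HG HG'; have [t [m [sw _]]] := exists_window (finsupp G ++ finsupp G').
have wG : {subset finsupp G <= window t m}.
  by move=> j jG; apply: sw; rewrite mem_cat jG.
have wG' : {subset finsupp G' <= window t m}.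
  by move=> j jG; apply: sw; rewrite mem_cat jG orbT.
have actE (E : NdN K N) x : {subset finsupp E <= window t m} -> dleft_act rho Q E x =
    \sum_(i < m.+1) E (i%:Z - t%:Z) * leval (rpoly (Q x)) (rmx_shift rho (i%:Z - t%:Z)).
  move=> wE; rewrite /dleft_act (big_window _ wE) ?fset_uniq // => j jE.
  by rewrite (fsfun_dflt jE) mul0r.
have eqw (i : 'I_m.+1) : G (i%:Z - t%:Z) - G' (i%:Z - t%:Z) = 0.
  move: i; apply: (@dual_moments_inj _ _ rho _ _ Q _ t).
  - exact: dual_rho dual.
  - exact: dual_vandermonde dual.
  - exact: dual_monic dual.
  move=> x; under eq_bigr do rewrite mulrBl.
  by rewrite sumrB -!actE // HG HG' subrr.
apply/fsfunP => j; have [|jw] := boolP (j \in window t m).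
  move=> /mapP[l]; rewrite mem_iota => /andP[_ lm] ->.
  by apply/eqP; rewrite -subr_eq0 (eqw (Ordinal lm)).
by rewrite !fsfun_dflt // (contraNN _ jw) //; [exact: wG'|exact: wG].
Qed.

(** The formula persists outside the support of [D], where both sides vanish. *)
Lemma sigmaE (D : MN K N) j x :
  sigma Ups D j x = ext0 Ups (x%:Z + j) * rmx_eval (D j) x * (Ups x)^-1.
Proof.
rewrite /sigma fsfunE; case: ifPn => // jD.
rewrite (fsfun_dflt jD) (@rmx_evalE _ _ _ _ 0) ?mulr0 ?mul0r //; exact: rmx_at0.
Qed.

Lemma dright_act_sigma_at (D : MN K N) (n x : nat) :
  rmx_at (dright_act rho Q (sigma Ups D) x) n%:R
    (\sum_(j <- finsupp D) leval (ext0 Q (x%:Z + j)) (rmx_eval rho n)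
       * (ext0 Ups (x%:Z + j) * rmx_eval (D j) x * (Ups x)^-1)).
Proof.
rewrite /dright_act (@eq_big_seq_supp _ _ _ (finsupp D)) ?fset_uniq //.
- apply: rmx_at_sum => j _; rewrite sigmaE; apply: rmx_atM; last exact: rmx_atC.
  exact/rmx_at_leval/rmx_at_eval/(dual_rho dual).
- by move=> j jS; rewrite (fsfun_dflt jS) rmorph0 mulr0.
- by move=> j jD; rewrite /sigma fsfunE (negPf jD) rmorph0 mulr0.
Qed.

(** The relation [M.P = P.D] evaluated at [x], with the duality inserted on both
    sides, [(P n).[0]] cancelled on the left and [Ups x] on the right. The
    vanishing condition of [hatFR] is what removes the terms with [x + j < 0],
    for which the duality says nothing about [P n] at [x + j]. *)
Lemma dual_relation (M : NN K N) (D : MN K N) (t m n x : nat) :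
  intertwine P M D -> hatFR P D -> {subset finsupp M <= window t m} -> (t <= n)%N ->
  \sum_(i < m.+1) (P n).[0]^-1 * M (i%:Z - t%:Z) n * (P (n - t + i)).[0]
      * leval (Q x) (rmx_eval rho (n - t + i)) =
  \sum_(j <- finsupp D) leval (ext0 Q (x%:Z + j)) (rmx_eval rho n)
     * (ext0 Ups (x%:Z + j) * rmx_eval (D j) x * (Ups x)^-1).
Proof.
move=> MD [_ Dvan] wM tn.
have Pu := dual_P0 dual n; have Uu := dual_Ups dual x.
have Dreg j : rmx_at (D j) x%:R (rmx_eval (D j) x).
  exact/rmx_at_eval/(intertwine_regular P_monic MD).
have scE y : (y%:R)%:M = y%:R :> mx by rewrite raddfMn.
have left_at : rmx_at (left_act P M n) x%:R
    (\sum_(i < m.+1) M (i%:Z - t%:Z) n * (P (n - t + i)).[x%:R]).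
  rewrite /left_act (big_window _ wM) ?fset_uniq //; last first.
    by move=> j jM; rewrite (fsfun_dflt jM) rmorph0 mul0r.
  apply: rmx_at_sum => i _; apply: rmx_atM; first exact: rmx_atC.
  have -> : n%:Z + (i%:Z - t%:Z) = (n - t + i)%N%:Z by lia.
  apply: rmx_at_horner; rewrite -scE.
  by have := @rmx_at_XD K N 0 x%:R; rewrite addr0.
have right_at : rmx_at (right_act P D n) x%:R
    (\sum_(j <- finsupp D) (P n).[(x%:R + j%:~R)%:M] * rmx_eval (D j) x).
  apply: rmx_at_sum => j _; apply: rmx_atM (Dreg j).
  exact/rmx_at_horner/rmx_at_XD.
rewrite MD in left_at; have := rmx_at_unique left_at right_at.
move=> /(congr1 (fun A => (P n).[0]^-1 * A * (Ups x)^-1)).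
rewrite !mulr_sumr !mulr_suml => E; apply: etrans (etrans E _).
  by apply: eq_bigr => i _; rewrite (dual_eq dual) !mulrA mulrK.
apply: eq_bigr => j _; case xj: (x%:Z + j) => [y|y] /=; last first.
  have Dj0 : rmx_eval (D j) x = 0 by apply/rmx_evalE/Dvan; rewrite xj.
  by rewrite Dj0 !(mulr0, mul0r).
have -> : (x%:R + j%:~R)%:M = y%:R :> mx.
  by rewrite pmulrn -intrD xj -pmulrn scE.
by rewrite (dual_eq dual) -!mulrA mulKr.
Qed.

(** Solving for the coefficients of the dual operator and proving that it
    intertwines both rest on [dual_relation]: first as moments known to be
    rational, then as an equality of values at infinitely many points. *)
Lemma tau_intertwines (M : NN K N) (D : MN K N) :
  intertwine P M D -> hatFR P D ->
  exists G : NdN K N, is_tau P M G /\ dintertwine rho Q (sigma Ups D) G.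
Proof.
move=> MD hD; have [t [m [wM tP]]] := exists_window (finsupp M).
pose g (i : 'I_m.+1) (n : nat) :=
  (P n).[0]^-1 * M (i%:Z - t%:Z) n * (P (n - t + i)).[0].
have [G HG] : exists G : 'I_m.+1 -> rm,
    forall i n, (t <= n)%N -> rmx_at (G i) n%:R (g i n).
  apply: (rational_of_dual_moments (dual_rho dual) (dual_vandermonde dual)
            (dual_monic dual)) => x.
  exists (dright_act rho Q (sigma Ups D) x) => n tn.
  by rewrite (dual_relation x MD hD wM tn); exact: dright_act_sigma_at.
pose Mt : NdN K N :=
  [fsfun j in [fset j in window t m]%fset => G (inord (absz (t%:Z + j))) | 0].
have MtE (i : 'I_m.+1) : Mt (i%:Z - t%:Z) = G i.
  rewrite fsfunE in_fset mem_window.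
  have -> : absz (t%:Z + (i%:Z - t%:Z)) = i by lia.
  by rewrite inord_val ifT //; have := ltn_ord i; lia.
have MtN j : j \notin window t m -> Mt j = 0.
  by move=> jw; rewrite fsfunE in_fset (negPf jw).
exists Mt; split.
  move=> j n /tP tn; have [|jw] := boolP (j \in window t m).
    move=> /mapP[l]; rewrite mem_iota => /andP[_ lm] ->.
    rewrite (MtE (Ordinal lm)).
    have -> : n%:Z + (l%:Z - t%:Z) = (n - t + l)%N%:Z by lia.
    exact: (HG (Ordinal lm)).
  rewrite MtN // fsfun_dflt; last by apply: contraNN jw; exact: wM.
  by rewrite mulr0 mul0r; exact: rmx_at0.
move=> x; apply: (@mat_at_eventually_inj _ _ _ _ _ t (fun n => 
  \sum_(i < m.+1) g i n * leval (Q x) (rmx_eval rho (n - t + i)))) => n tn.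
  rewrite /dleft_act (@big_window _ _ t m) ?fset_uniq //.
  - apply: rmx_at_sum => i _; rewrite MtE; apply: rmx_atM; first exact: HG.
    apply: rmx_at_leval; apply: rmx_at_rho_shift => //; exact: dual_rho dual.
  - by move=> j; rewrite mem_finsupp; apply: contraNT => /MtN ->.
  - by move=> j jM; rewrite (fsfun_dflt jM) mul0r.
by rewrite (dual_relation x MD hD wM tn); exact: dright_act_sigma_at.
Qed.

End Dual.

Theorem theorem3p22 (R : realType) (N : nat)
    (W : int -> 'M[R[i]]_N.+1) (P : nat -> {poly 'M[R[i]]_N.+1})
    (rho : 'M[ratfun R[i]]_N.+1) (Ups : nat -> 'M[R[i]]_N.+1)
    (Q : nat -> {poly 'M[R[i]]_N.+1}) :
  is_weight W -> is_mop W P -> is_dual_family W P rho Ups Q ->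
  [/\ hatFdR P Ups `<=` FdR rho Q,
      hatFdL P `<=` FdL rho Q,
      forall M, hatFL P M -> is_tau P M (tau P M)
    & forall M, hatFL P M -> tau P M = psid rho Q (sigma Ups (psi P M))].
Proof.
move=> _ [P_monic _] dual.
have core M : hatFL P M ->
    is_tau P M (tau P M) /\ dintertwine rho Q (sigma Ups (psi P M)) (tau P M).
  move=> [FLM hD]; have MD : intertwine P M (psi P M) by exact: xgetPex.
  have [G [tG iG]] := tau_intertwines P_monic dual MD hD.
  suff -> : tau P M = G by [].
  by apply: xget_unique => // G' tG'; exact: tau_unique tG' tG.
split.
- move=> _ [D hD <-]; have [[M MD] _] := hD.
  by have [G [_ iG]] := tau_intertwines P_monic dual MD hD; exists G.
- by move=> _ [M /core[_ iM] <-]; exists (sigma Ups (psi P M)).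
- by move=> M /core[].
- move=> M /core[_ iM]; apply/esym; apply: xget_unique => // G iG.
  exact: psid_unique dual _ _ _ iG iM.
Qed.
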